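(* Let $L$ be a finite crosscut-simplicial lattice. (1) If $\Theta$ is a lattice congruence of $L$, then the quotient lattice $L/\Theta$ is crosscut-simplicial. (2) If $C$ is an order filter of $L$, then the doubling $L[C]$ of $L$ at $C$ is crosscut-simplicial.
   Context: All posets and lattices are finite. For $x\le y$ in a lattice $L$, an atom of the interval $[x,y]=\{z: x\le z\le y\}$ is an element $z$ covering $x$ with $z\le y$. A lattice $L$ is crosscut-simplicial if for every interval $[x,y]$ of $L$ and every proper subset $B$ of the set of atoms of $[x,y]$, the join of $B$ computed in $[x,y]$ (so the empty join is $x$) is not equal to $y$. A lattice congruence $\Theta$ of $L$ is an equivalence relation on $L$ such that $x\equiv y\ (\Theta)$ implies $x\vee z\equiv y\vee z\ (\Theta)$ and $x\wedge z\equiv y\wedge z\ (\Theta)$ for all $x,y,z\in L$. The quotient lattice $L/\Theta$ is the set of equivalence classes, ordered by $[x]\le[y]$ if there exist $x'\in[x]$ and $y'\in[y]$ with $x'\le y'$. An order filter of $L$ is an upward closed subset $C\subseteq L$: if $x\in C$, $y\in L$ and $x\le y$, then $y\in C$. For a subset $C$ of a poset $P$, let $P_{\ge C}=\{x\in P: x\ge c\text{ for some }c\in C\}$. A subset $C$ is order-convex if $x,y\in C$, $x\le y$ imply $[x,y]\subseteq C$ (order filters are order-convex). The doubling $P[C]$ of $P$ at an order-convex subset $C$ is the induced subposet of the product poset $P\times\{0,1\}$ (with $0<1$) on the set $$P[C]=\big((P\setminus P_{\ge C})\cup C\big)\times\{0\}\ \cup\ P_{\ge C}\times\{1\}.$$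 If $L$ is a lattice, then $L[C]$ is a lattice. *)

(* Defs.v *)
From HB Require Import structures.
From mathcomp Require Import all_boot all_order.

Set Implicit Arguments.
Unset Strict Implicit.
Unset Printing Implicit Defensive.

Import Order.LTheory.

Local Open Scope order_scope.

Definition covers d (P : finPOrderType d) (x z : P) : bool :=
  (x < z) && [forall w : P, ~~ ((x < w) && (w < z))].

Definition interval_atoms d (P : finPOrderType d) (x y : P) : {set P} :=
  [set z | covers x z && (z <= y)].

(* The join of B inside the interval [x, y], for B a subset of [x, y]: folding
   from x makes the empty join x and changes no other join
   (see [interval_join_le]). *)
Definition interval_join d (L : finLatticeType d) (x : L) (B : {set L}) : L :=
  \big[Order.join/x]_(b in B) b.

Lemma interval_join_le d (L : finLatticeType d) (x : L) (B : {set L}) (u : L) :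
  (interval_join x B <= u) = (x <= u) && [forall b in B, b <= u].
Proof.
apply/idP/andP => [le_u | [le_xu /forall_inP le_Bu]]; last first.
  by rewrite /interval_join; elim/big_ind: _ => // v w; rewrite leUx => -> ->.
rewrite /interval_join -big_filter in le_u.
have {le_u} [le_xu le_Bu] :
    x <= u /\ forall b, b \in [seq b <- index_enum L | b \in B] -> b <= u.
  elim: [seq _ <- _ | _] le_u => [|b s IHs]; first by rewrite big_nil.
  rewrite big_cons leUx => /andP[le_bu /IHs[le_xu le_su]].
  by split=> // c; rewrite inE => /predU1P[-> //|]; apply: le_su.
split=> //; apply/forall_inP => b bB; apply: le_Bu.
by rewrite mem_filter bB mem_index_enum.
Qed.

Definition crosscut_simplicial d (L : finLatticeType d) : Prop :=
  forall x y : L, x <= y ->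
  forall B : {set L}, B \proper interval_atoms x y -> interval_join x B != y.

Definition lattice_congruence d (L : finLatticeType d) (Theta : rel L) : Prop :=
  equivalence_rel Theta /\
  forall x y z : L, Theta x y ->
    Theta (x `|` z) (y `|` z) /\ Theta (x `&` z) (y `&` z).

(* The congruence proof is a phantom argument, from which the lattice instance
   below is inferred; likewise for convexity in [doubling]. *)
Definition congruence_quotient d (L : finLatticeType d) (Theta : rel L)
    (_ : lattice_congruence Theta) : predArgType :=
  {A : {set L} | A \in equivalence_partition Theta [set: L]}.

Section CongruenceQuotient.

Context d (L : finLatticeType d) (Theta : rel L).
Hypothesis congTheta : lattice_congruence Theta.

Local Notation Q := (congruence_quotient congTheta).

HB.instance Definition _ := SubFinite.on Q.

Definition quotient_le : rel Q := fun A B =>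
  [exists x in val A, exists y in val B, x <= y].

Let Theta_refl : reflexive Theta.
Proof. by move=> x; case: congTheta => E _; have [] := E x x x. Qed.

Let Theta_sym : symmetric Theta.
Proof.
move=> x y; case: congTheta => E _.
by apply/idP/idP => h; [have [_ /(_ h)] := E x y x | have [_ /(_ h)] := E y x y];
  rewrite Theta_refl => <-.
Qed.

Let Theta_trans : transitive Theta.
Proof.
by move=> y x z xy yz; case: congTheta => E _; have [_ ->] := E x y z.
Qed.

Let Theta_join x x' y y' : Theta x x' -> Theta y y' ->
  Theta (x `|` y) (x' `|` y').
Proof.
case: congTheta => _ h hx hy; apply: (@Theta_trans (x' `|` y)).
  by case: (h _ _ y hx).
by rewrite !(joinC x'); case: (h _ _ x' hy).
Qed.

Let Theta_meet x x' y y' : Theta x x' -> Theta y y' ->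
  Theta (x `&` y) (x' `&` y').
Proof.
case: congTheta => _ h hx hy; apply: (@Theta_trans (x' `&` y)).
  by case: (h _ _ y hx).
by rewrite !(meetC x'); case: (h _ _ x' hy).
Qed.

Fact class_of_subproof (x : L) :
  [set y | Theta x y] \in equivalence_partition Theta [set: L].
Proof. by apply/imsetP; exists x => //; apply/setP => y; rewrite !inE. Qed.

Definition congruence_class (x : L) : Q :=
  exist (fun A : {set L} => A \in equivalence_partition Theta [set: L])
    _ (class_of_subproof x).

Let val_class x y : (y \in val (congruence_class x)) = Theta x y.
Proof. by rewrite inE. Qed.

Lemma congruence_classP (A : Q) : exists x, A == congruence_class x.
Proof.
have /imsetP[x _ defA] := valP A; exists x; apply/eqP/val_inj.
by rewrite defA; apply/setP => y; rewrite !inE.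
Qed.

Definition quotient_repr (A : Q) : L := xchoose (congruence_classP A).

Let quotient_reprK : cancel quotient_repr congruence_class.
Proof. by move=> A; rewrite -(eqP (xchooseP (congruence_classP A))). Qed.

Let leE x y : quotient_le (congruence_class x) (congruence_class y)
  = Theta (x `|` y) y.
Proof.
apply/exists_inP/idP => [[x' ] | hxy]; last first.
  exists x; first by rewrite val_class.
  apply/exists_inP; exists (x `|` y); last exact: leUl.
  by rewrite val_class Theta_sym.
rewrite val_class => xx' /exists_inP[y']; rewrite val_class => yy' le_xy.
apply: (Theta_trans (Theta_join xx' yy')).
by rewrite (elimT join_idPr le_xy) Theta_sym.
Qed.

Let class_eq x y : Theta x y -> congruence_class x = congruence_class y.
Proof.
move=> xy; apply: val_inj; apply/setP => z; rewrite !inE.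
by apply/idP/idP; apply: Theta_trans; rewrite // Theta_sym.
Qed.

Fact quotient_le_refl : reflexive quotient_le.
Proof. by move=> A; rewrite -(quotient_reprK A) leE joinxx. Qed.

Fact quotient_le_anti : antisymmetric quotient_le.
Proof.
move=> A B; rewrite -(quotient_reprK A) -(quotient_reprK B) !leE joinC.
move=> /andP[hB hA]; apply: class_eq; apply: (Theta_trans _ hB).
by rewrite Theta_sym.
Qed.

Fact quotient_le_trans : transitive quotient_le.
Proof.
move=> B A C; rewrite -(quotient_reprK A) -(quotient_reprK B).
rewrite -(quotient_reprK C) !leE.
move: (quotient_repr A) (quotient_repr B) (quotient_repr C) => a b c ab bc.
have h1 := Theta_join (Theta_refl a) bc.
apply: (@Theta_trans (a `|` (b `|` c))); first by rewrite Theta_sym.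
by rewrite joinA; apply: (Theta_trans (Theta_join ab (Theta_refl c))).
Qed.

HB.instance Definition _ := Order.Le_isPOrder.Build d Q
  quotient_le_refl quotient_le_anti quotient_le_trans.

Definition quotient_join (A B : Q) : Q :=
  congruence_class (quotient_repr A `|` quotient_repr B).

Definition quotient_meet (A B : Q) : Q :=
  congruence_class (quotient_repr A `&` quotient_repr B).

Let leEm x y : quotient_le (congruence_class x) (congruence_class y)
  = Theta (x `&` y) x.
Proof.
rewrite leE; apply/idP/idP => h.
  have := Theta_meet (Theta_refl x) h.
  by rewrite joinKI Theta_sym.
have := Theta_join h (Theta_refl y).
by rewrite (elimT join_idPr (leIr y x)) Theta_sym.
Qed.

Fact quotient_meetP (A B C : Q) :
  (A <= quotient_meet B C) = (A <= B) && (A <= C).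
Proof.
rewrite -(quotient_reprK A) -{2}(quotient_reprK B) -{2}(quotient_reprK C).
rewrite /quotient_meet /Order.le /= !leEm.
move: (quotient_repr A) (quotient_repr B) (quotient_repr C) => a b c.
apply/idP/andP => [h | [hb hc]].
  split.
    have := Theta_meet h (Theta_refl b); rewrite Theta_sym => h1.
    apply: (Theta_trans h1).
    by rewrite -meetA -[b `&` c `&` b]meetC meetA -meetA meetKI.
  have := Theta_meet h (Theta_refl c); rewrite Theta_sym => h1.
  by apply: (Theta_trans h1); rewrite -!meetA meetxx.
rewrite meetA; apply: (Theta_trans _ hc).
exact: Theta_meet hb (Theta_refl c).
Qed.

Fact quotient_joinP (A B C : Q) :
  (quotient_join A B <= C) = (A <= C) && (B <= C).
Proof.
rewrite -(quotient_reprK C) -{2}(quotient_reprK A) -{2}(quotient_reprK B).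
rewrite /quotient_join /Order.le /= !leE.
move: (quotient_repr A) (quotient_repr B) (quotient_repr C) => a b c.
apply/idP/andP => [h | [ha hb]].
  split.
    have := Theta_join (Theta_refl a) h; rewrite Theta_sym => h1.
    by apply: (Theta_trans h1); rewrite !joinA joinxx.
  have := Theta_join (Theta_refl b) h; rewrite Theta_sym => h1.
  apply: (Theta_trans h1).
  by rewrite !joinA (joinC b a) -(joinA a b b) joinxx.
rewrite -joinA; apply: (Theta_trans _ ha).
exact: Theta_join (Theta_refl a) hb.
Qed.

HB.instance Definition _ := Order.POrder_MeetJoin_isLattice.Build d Q
  quotient_meetP quotient_joinP.

End CongruenceQuotient.

Definition order_filter d (P : finPOrderType d) (C : {set P}) : Prop :=
  forall x y : P, x \in C -> x <= y -> y \in C.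

Definition order_convex d (P : finPOrderType d) (C : {set P}) : Prop :=
  forall x y z : P, x \in C -> y \in C -> x <= z -> z <= y -> z \in C.

Lemma order_filter_convex d (P : finPOrderType d) (C : {set P}) :
  order_filter C -> order_convex C.
Proof. by move=> filC x y z xC _ xz _; apply: filC xz. Qed.

Definition upper_set d (P : finPOrderType d) (C : {set P}) : {set P} :=
  [set x | [exists c in C, c <= x]].

Definition doubling_set d (P : finPOrderType d) (C : {set P}) :
    {set P *p bool} :=
  setX ((~: upper_set C) :|: C) [set false] :|: setX (upper_set C) [set true].

Definition doubling d (P : finPOrderType d) (C : {set P})
    (_ : order_convex C) : predArgType :=
  {p : P *p bool | p \in doubling_set C}.

Section DoublingPoset.

Context d (P : finPOrderType d) (C : {set P}) (convC : order_convex C).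

HB.instance Definition _ := SubFinite.on (doubling convC).
HB.instance Definition _ := [SubChoice_isSubPOrder of doubling convC by <:
  with Order.prod_display d Order.BoolOrder.bool_display].

End DoublingPoset.

Section DoublingLattice.

Context d (L : finLatticeType d) (C : {set L}) (convC : order_convex C).

Local Notation D := (doubling convC).
Local Notation U := (upper_set C).

Let in_doubling x (i : bool) : ((x, i) \in doubling_set C) =
  if i then x \in U else (x \notin U) || (x \in C).
Proof. by rewrite !inE /=; case: i; rewrite ?andbT ?andbF ?orbF. Qed.

Let upperW (x y : L) : x <= y -> x \in U -> y \in U.
Proof.
rewrite !inE => xy /exists_inP[c cC cx]; apply/exists_inP; exists c => //.
exact: le_trans xy.
Qed.

Let convU (x y : L) : x \in U -> x <= y -> y \in C -> x \in C.
Proof. by rewrite inE => /exists_inP[c cC cx] xy yC; apply: (convC cC yC). Qed.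

Definition doubling_join_val (p q : L *p bool) : L *p bool :=
  let z := p.1 `|` q.1 in (z, [|| p.2, q.2 | (z \in U) && (z \notin C)]).

Definition doubling_meet_val (p q : L *p bool) : L *p bool :=
  let z := p.1 `&` q.1 in (z, [&& p.2, q.2 & z \in U]).

Fact doubling_join_subproof (p q : D) :
  doubling_join_val (val p) (val q) \in doubling_set C.
Proof.
case: p q => [[x i] px] [[y j] qy] /=; rewrite /doubling_join_val /= in_doubling.
move: px qy; rewrite !in_doubling; case: i => [xU _|_].
  exact: upperW (leUl _ _) xU.
case: j => [yU|_] /=; first exact: upperW (leUr _ _) yU.
by case: (_ \in U); case: (_ \in C).
Qed.

Fact doubling_meet_subproof (p q : D) :
  doubling_meet_val (val p) (val q) \in doubling_set C.
Proof.
case: p q => [[x i] px] [[y j] qy] /=; rewrite /doubling_meet_val /= in_doubling.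
move: px qy; rewrite !in_doubling.
have [zU|//] := boolP (x `&` y \in U); last by rewrite !andbF.
have xU := upperW (leIl x y) zU; have yU := upperW (leIr y x) zU.
rewrite xU yU; case: i => /= [_|xC _]; last exact: convU (leIl _ _) xC.
by case: j => //= yC; apply: convU (leIr _ _) yC.
Qed.

Definition doubling_join (p q : D) : D :=
  exist (fun r => r \in doubling_set C) _ (doubling_join_subproof p q).
Definition doubling_meet (p q : D) : D :=
  exist (fun r => r \in doubling_set C) _ (doubling_meet_subproof p q).

Let leE (p q : D) :
  (p <= q) = ((val p).1 <= (val q).1) && ((val p).2 ==> (val q).2).
Proof.
case: p q => [[x i] px] [[y j] qy]; rewrite leEsub leEprod.
by case: i px; case: j qy.
Qed.

Fact doubling_meetP (p q r : D) :
  (p <= doubling_meet q r) = (p <= q) && (p <= r).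
Proof.
rewrite !leE /= lexI; case: p q r => [[x i] px] [[y j] py] [[z k] pz] /=.
have [xy|] := boolP (x <= y) => //=; have [xz|] := boolP (x <= z) => //=;
  rewrite ?andbF //.
move: px; rewrite in_doubling; case: i => //= xU.
by rewrite (upperW _ xU) ?lexI ?xy // andbT.
Qed.

Fact doubling_joinP (p q r : D) :
  (doubling_join p q <= r) = (p <= r) && (q <= r).
Proof.
rewrite !leE /= leUx; case: p q r => [[x i] px] [[y j] py] [[z k] pz] /=.
have [xz|] := boolP (x <= z) => //=; have [yz|] := boolP (y <= z) => //=;
  rewrite ?andbF //.
have xyz : x `|` y <= z by rewrite leUx xz.
move: pz; rewrite in_doubling; case: k => [_|/= pz]; first by rewrite !implybT.
suff -> : (x `|` y \in U) && (x `|` y \notin C) = false.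
  by rewrite orbF; case: i j {px py} => [] [].
apply/andP => -[wU /negP[]]; move: pz; rewrite (upperW xyz wU) /=.
exact: convU.
Qed.

HB.instance Definition _ := Order.POrder_MeetJoin_isLattice.Build _ D
  doubling_meetP doubling_joinP.

End DoublingLattice.

(* Main.v *)
Require Import Defs.
From HB Require Import structures.
From mathcomp Require Import all_boot all_order.

(** Crosscut-simpliciality only concerns the covers of one element at a time:
    it says that a cover of [x] lying below a join of covers of [x] is already
    one of them ([crosscut_simplicialP]).  Both parts are proved in this form.

    Quotients: the projection to the quotient is a surjective lattice morphism
    [f], and the property passes along any such [f]
    ([crosscut_simplicial_image]).  Given [X], let [x] be maximal in the fibre
    over [X].  Every cover [Z] of [X] is the image of a cover [z] of [x], and no
    cover of [x] is sent to [X].  If [Z] is below the join of a set of covers of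
    [X], let [u] be the join of the covers of [x] mapped into that set; then
    [z `&` u] lies between [x] and [z] and is mapped to [Z], so it is [z], that
    is, [z <= u].

    Doublings: for a filter [C] the doubling consists of all the [(x, false)]
    and of the [(x, true)] with [x] in [C].  A cover of [(x, i)] either keeps
    the bit and covers [x] in the first coordinate, or is [(x, true)] over
    [(x, false)] ([doubling_covers]).  Covers of the first kind are controlled
    by the first projection, a join morphism to the given lattice; a cover of
    the second kind cannot lie below a join of elements with bit [false]. *)

Set Implicit Arguments.
Unset Strict Implicit.
Unset Printing Implicit Defensive.

Import Order.LTheory.

Local Open Scope order_scope.

(** * Minimal elements and covers in finite posets *)

Lemma ex_minimal d (P : finPOrderType d) (A : {set P}) (a : P) : a \in A ->
  exists2 m, m \in A & forall w, w \in A -> ~~ (w < m).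
Proof.
move=> aA; case: (arg_minnP (fun m : P => #|[set w | w < m]|) aA) => m mA min_m.
exists m => // w wA; apply/negP => ltwm; have := min_m w wA.
rewrite leqNgt => /negP[]; apply: proper_card; apply/properP; split.
  by apply/subsetP => v; rewrite !inE => /lt_trans; apply.
by exists w; rewrite !inE ?ltwm ?ltxx.
Qed.

Lemma ex_maximal d (P : finPOrderType d) (A : {set P}) (a : P) : a \in A ->
  exists2 m, m \in A & forall w, w \in A -> ~~ (m < w).
Proof. exact: (@ex_minimal _ P^d A a). Qed.

Lemma coversP d (P : finPOrderType d) (x z : P) :
  reflect (x < z /\ forall w, x < w -> w < z -> False) (covers x z).
Proof.
apply: (iffP andP) => -[xz h]; split=> //.
  by move=> w xw wz; move/forallP/(_ w): h; rewrite xw wz.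
by apply/forallP => w; apply/negP => /andP[xw wz]; apply: (h w).
Qed.

Lemma covers_eq d (P : finPOrderType d) (x w z : P) :
  covers x z -> x < w -> w <= z -> w = z.
Proof.
case/coversP=> _ h xw; rewrite le_eqVlt => /predU1P[//|wz].
by case: (h w).
Qed.

Lemma ex_cover_le d (P : finPOrderType d) (x y : P) : x < y ->
  exists2 z, covers x z & z <= y.
Proof.
move=> xy; have yA : y \in [set w | x < w & w <= y] by rewrite inE xy lexx.
have [z] := ex_minimal yA; rewrite inE => /andP[xz zy] min_z.
exists z => //; apply/coversP; split=> // w xw wz.
have /min_z : w \in [set w | x < w & w <= y].
  by rewrite inE xw (le_trans (ltW wz)).
by rewrite wz.
Qed.

(** * Joins of covers *)

Lemma interval_join_ge d (L : finLatticeType d) (x : L) (B : {set L}) :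
  x <= interval_join x B.
Proof. by have := lexx (interval_join x B); rewrite interval_join_le => /andP[]. Qed.

Lemma interval_join_ub d (L : finLatticeType d) (x b : L) (B : {set L}) :
  b \in B -> b <= interval_join x B.
Proof.
move=> bB; have := lexx (interval_join x B).
by rewrite interval_join_le => /andP[_ /forall_inP]; apply.
Qed.

Lemma interval_join_subset d (L : finLatticeType d) (x : L) (A B : {set L}) :
  A \subset x |: B -> interval_join x A <= interval_join x B.
Proof.
move=> /subsetP sAB; rewrite interval_join_le interval_join_ge /=.
apply/forall_inP => a /sAB; rewrite !inE => /predU1P[->|].
  exact: interval_join_ge.
exact: interval_join_ub.
Qed.

Lemma interval_join_morph d d' (L : finLatticeType d) (M : finLatticeType d')
    (f : L -> M) (x : L) (B : {set L}) :
  {morph f : a b / a `|` b} ->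
  f (interval_join x B) = interval_join (f x) (f @: B).
Proof.
move=> fU; apply/le_anti/andP; split; last first.
  have f_le a b : a <= b -> f a <= f b by rewrite !leEjoin -fU => /eqP->.
  rewrite interval_join_le f_le ?interval_join_ge //=.
  by apply/forall_inP => _ /imsetP[b bB ->]; rewrite f_le ?interval_join_ub.
rewrite /interval_join (big_morph f fU (erefl (f x))) -/(interval_join _ _).
elim/big_ind: _ => [|u v hu hv|b bB]; first exact: interval_join_ge.
  by rewrite leUx hu.
exact/interval_join_ub/imset_f.
Qed.

(** The upper end of the interval disappears: a set [B] of covers of [x] is a set
    of atoms of the interval from [x] to its own join, and the definition says
    that it is the set of all of them. *)
Lemma crosscut_simplicialP d (L : finLatticeType d) :
  crosscut_simplicial L <->
  forall (x : L) (B : {set L}), {in B, forall b, covers x b} ->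
  forall z, covers x z -> z <= interval_join x B -> z \in B.
Proof.
split=> [csL x B covB z xz zB | h x y _ B /properP[/subsetP sB [z]]].
  apply/negPn/negP => zNB.
  have := csL x _ (interval_join_ge x B) B; rewrite eqxx => /(_ _)/negP.
  apply=> //; apply/properP; split; last by exists z; rewrite // inE xz.
  by apply/subsetP => b bB; rewrite inE covB // interval_join_ub.
rewrite inE => /andP[xz zy] zNB; apply/negP => /eqP eqy.
case/negP: zNB; apply: (h x) => //; last by rewrite eqy.
by move=> b /sB; rewrite inE => /andP[].
Qed.

(** * Quotients *)

Section Image.

Context d d' (L : finLatticeType d) (M : finLatticeType d') (f : L -> M).
Hypothesis fU : {morph f : a b / a `|` b}.

(** Over a maximal element of a fibre, covers lift: joining [x] with any preimage
    of [Z] gives a preimage of [Z] above [x], and a cover of [x] below that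
    preimage is mapped above [f x] by maximality. *)
Lemma lift_cover (x : L) (Z : M) :
  (forall M0, exists a, f a = M0) -> (forall w, x < w -> f w != f x) ->
  covers (f x) Z -> exists2 z, covers x z & f z = Z.
Proof.
move=> f_surj max_x covZ; have /coversP[ltXZ _] := covZ.
have f_le a b : a <= b -> f a <= f b by rewrite !leEjoin -fU => /eqP->.
have [a fa] := f_surj Z.
have fxa : f (x `|` a) = Z by rewrite fU fa (join_idPr (ltW ltXZ)).
have ltxa : x < x `|` a.
  rewrite lt_def leUl andbT; apply/eqP => eqx.
  by rewrite -fxa eqx ltxx in ltXZ.
have [z covz lez] := ex_cover_le ltxa; exists z => //.
have /coversP[ltxz _] := covz.
apply: (covers_eq covZ); last by rewrite -fxa f_le.
by rewrite lt_def max_x // f_le // ltW.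
Qed.

Lemma crosscut_simplicial_image :
  {morph f : a b / a `&` b} -> (forall Z, exists a, f a = Z) ->
  crosscut_simplicial L -> crosscut_simplicial M.
Proof.
move=> fI f_surj /crosscut_simplicialP csL; apply/crosscut_simplicialP.
move=> X B covB Z covZ leZ; have [x0 fx0] := f_surj X.
have x0F : x0 \in [set a | f a == X] by rewrite inE fx0.
have [x] := ex_maximal x0F; rewrite inE => /eqP fx max_fibre.
rewrite -fx in covB covZ leZ.
have max_x w : x < w -> f w != f x.
  by apply: contraTneq => fw; apply: max_fibre; rewrite inE fw fx.
have lift := lift_cover f_surj max_x.
pose B' := [set b | covers x b & f b \in B].
have fB' : f @: B' = B.
  apply/setP => b; apply/imsetP/idP => [[a]|bB].
    by rewrite inE => /andP[_ ?] ->.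
  have [a cova fa] := lift b (covB b bB).
  by exists a; rewrite // inE cova fa.
have [z covz fz] := lift Z covZ; have /coversP[ltxz _] := covz.
suff : z \in B' by rewrite inE fz => /andP[].
apply: (csL x) => //; first by move=> b; rewrite inE => /andP[].
apply/meet_idPl; apply: (covers_eq covz); last exact: leIl.
rewrite lt_def lexI (ltW ltxz) interval_join_ge !andbT.
(* were the meet equal to [x], its image [Z] would be [f x] *)
apply/eqP => /(congr1 f); rewrite fI interval_join_morph // fB' fz.
rewrite (meet_idPl leZ) => eqZ.
by case/coversP: covZ; rewrite eqZ ltxx.
Qed.

End Image.

Section Quotient.

Context d (L : finLatticeType d) (Theta : rel L).
Hypothesis congTheta : lattice_congruence Theta.

Local Notation cl := (congruence_class congTheta).

Lemma congruence_class_eq x y : (cl x == cl y) = Theta x y.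
Proof.
have [E _] := congTheta.
have Txx a : Theta a a by have [] := E a a a.
apply/eqP/idP => [/(congr1 val)/setP/(_ y)|xy]; first by rewrite !inE Txx.
apply: val_inj; apply/setP => z; rewrite !inE.
by have [_ ->] := E x y z.
Qed.

Lemma congruence_class_repr (A : congruence_quotient congTheta) :
  cl (quotient_repr A) = A.
Proof. by rewrite -(eqP (xchooseP (congruence_classP A))). Qed.

(** The lattice operations of the quotient are computed on representatives, so a
    congruence lets them be computed on any elements of the classes. *)
Lemma congruence_class_morph2 (op : L -> L -> L) :
  commutative op -> (forall x y z, Theta x y -> Theta (op x z) (op y z)) ->
  forall x y, cl (op x y) = cl (op (quotient_repr (cl x)) (quotient_repr (cl y))).
Proof.
move=> opC opT x y.
have reprT z : Theta z (quotient_repr (cl z)).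
  by rewrite -congruence_class_eq congruence_class_repr.
transitivity (cl (op (quotient_repr (cl x)) y)).
  by apply/eqP; rewrite congruence_class_eq opT.
by apply/eqP; rewrite !(opC (quotient_repr (cl x))) congruence_class_eq opT.
Qed.

Lemma crosscut_simplicial_quotient :
  crosscut_simplicial L -> crosscut_simplicial (congruence_quotient congTheta).
Proof.
have [_ cT] := congTheta.
apply: (@crosscut_simplicial_image _ _ _ _ (fun x => cl x)) => [x y|x y|A].
- apply: congruence_class_morph2 => [a b|a b c /(cT _ _ c)[] //].
  exact: joinC.
- apply: congruence_class_morph2 => [a b|a b c /(cT _ _ c)[] //].
  exact: meetC.
- by exists (quotient_repr A); apply: congruence_class_repr.
Qed.

End Quotient.

(** * Doublings at order filters *)

Section Doubling.

Context d (L : finLatticeType d) (C : {set L}).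
Hypothesis filC : order_filter C.

Local Notation D := (doubling (order_filter_convex filC)).

Lemma upper_set_filter : upper_set C = C.
Proof.
apply/setP => x; rewrite inE; apply/exists_inP/idP => [[c cC]|xC].
  exact: filC.
by exists x.
Qed.

Lemma in_doubling_filter x (i : bool) :
  ((x, i) \in doubling_set C) = i ==> (x \in C).
Proof.
rewrite /doubling_set upper_set_filter !inE /=.
by case: i; rewrite /= ?andbT ?andbF ?orbF // orNb.
Qed.

Lemma doubling_val (x : L) (i : bool) : i ==> (x \in C) ->
  exists p : D, val p = (x, i).
Proof. by rewrite -in_doubling_filter => xi; exists (Sub (x, i) xi); rewrite SubK. Qed.

Lemma doubling_leE (p q : D) :
  (p <= q) = ((val p).1 <= (val q).1) && ((val p).2 ==> (val q).2).
Proof.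
case: p q => [[x i] px] [[y j] qy]; rewrite -Order.le_val leEprod.
by case: i px; case: j qy.
Qed.

(** Changing both coordinates is never a cover, because the doubling contains
    [(z, false)] for every [z]. *)
Lemma doubling_covers (p q : D) : covers p q ->
  (val q).2 = (val p).2 /\ covers (val p).1 (val q).1 \/
  (val p).2 = false /\ val q = ((val p).1, true).
Proof.
move=> covq; have /coversP[ltpq _] := covq.
have := ltW ltpq; rewrite doubling_leE => /andP[lexz leij].
case: p q => [[x i] px] [[z j] qz] /= in covq ltpq lexz leij *.
have [eqij|neqij] := eqVneq j i.
  left; split=> //; subst j; apply/coversP; split.
    rewrite lt_def lexz andbT; apply: contraTneq ltpq => eqz.
    by rewrite lt_def; apply/nandP; left; apply/negPn/eqP/val_inj; rewrite /= eqz.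
  move=> w xw wz; move: (px); rewrite in_doubling_filter => xi.
  have [|r vr] := @doubling_val w i.
    by apply/implyP => i1; rewrite i1 in xi; apply: filC xi (ltW xw).
  have eqr : r = exist _ (z, i) qz.
    apply: (covers_eq covq); last by rewrite doubling_leE vr /= ltW //= implybb.
    rewrite lt_def doubling_leE vr /= ltW //= implybb andbT.
    by apply: contraTneq xw => /(congr1 val); rewrite vr => -[->]; rewrite ltxx.
  by move: vr wz; rewrite eqr => -[->]; rewrite ltxx.
right; case: i j leij neqij => [] [] // _ _ in px qz covq ltpq *.
have [//|r vr] := @doubling_val z false.
suff -> : x = z by [].
apply/eqP; apply: contraT => neqxz.
have eqr : r = exist _ (z, true) qz.
  apply: (covers_eq covq); last by rewrite doubling_leE vr /= lexx.
  rewrite lt_def doubling_leE vr /= lexz !andbT.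
  by apply: contraNneq neqxz => /(congr1 val); rewrite vr => -[->].
by move: vr; rewrite eqr.
Qed.

Lemma crosscut_simplicial_doubling :
  crosscut_simplicial L -> crosscut_simplicial D.
Proof.
move=> /crosscut_simplicialP csL; apply/crosscut_simplicialP => p B covB q covq leq.
have [[eq2 cov1]|[p2 vq]] := doubling_covers covq.
  pose B' := [set z | covers (val p).1 z & [exists b in B, val b == (z, (val p).2)]].
  suff : (val q).1 \in B'.
    rewrite inE -eq2 -surjective_pairing => /andP[_ /exists_inP[b bB]].
    by move=> /eqP/val_inj <-.
  apply: (csL (val p).1) => //; first by move=> z; rewrite inE => /andP[].
  pose f (r : D) := (val r).1.
  have fU : {morph f : a b / a `|` b} by [].
  move: leq; rewrite doubling_leE => /andP[/le_trans le1 _]; apply: le1.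
  rewrite -/(f _) (interval_join_morph _ _ fU); apply: interval_join_subset.
  apply/subsetP => _ /imsetP[b bB ->]; rewrite !inE.
  have [[b2 ->]|[_ vb]] := doubling_covers (covB b bB).
    by apply/orP; right; apply/exists_inP; exists b; rewrite // -b2 -surjective_pairing.
  by rewrite /f vb eqxx.
apply: contraT => qNB.
(* otherwise [B] lies in the bottom copy of the lattice, below some [r] there *)
have [//|r vr] := @doubling_val (val (interval_join p B)).1 false.
suff ler : interval_join p B <= r.
  by have := le_trans leq ler; rewrite doubling_leE vq vr andbF.
have le_r s : s <= interval_join p B -> (val s).2 = false -> s <= r.
  by rewrite !doubling_leE vr => /andP[-> _] ->.
rewrite interval_join_le le_r ?interval_join_ge //=.
apply/forall_inP => b bB; apply: le_r; first exact: interval_join_ub.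
have [[-> _] //|[_ vb]] := doubling_covers (covB b bB).
by case/negP: qNB; rewrite (_ : q = b) //; apply: val_inj; rewrite vq vb.
Qed.

End Doubling.

Theorem theorem1p1 (d : Order.disp_t) (L : finLatticeType d) :
  crosscut_simplicial L ->
  (forall (Theta : rel L) (congTheta : lattice_congruence Theta),
     crosscut_simplicial (congruence_quotient congTheta)) /\
  (forall (C : {set L}) (filC : order_filter C),
     crosscut_simplicial (doubling (order_filter_convex filC))).
Proof.
move=> csL; split=> [Theta congTheta | C filC].
  exact: crosscut_simplicial_quotient.
exact: crosscut_simplicial_doubling.
Qed.
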